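(* Let $(\mathbf{A},\mathbf{B},\triangleright,\triangleleft,|\cdots|)$ be a matched pair of groupoids (that is, a matched pair of categories with common object set $S$ such that $\mathbf{A}$ and $\mathbf{B}$ are groupoids). Then the bicrossed product $\mathbf{A}\Join\mathbf{B}$ is also a groupoid.
   Context: Categories here are ordinary small categories. For a category $\mathbf{A}$ with object set $S$, ${}_xA_y$ denotes the set of morphisms from $y$ to $x$, so composition is a map ${}_xA_y\times{}_yA_z\to{}_xA_z$, $(g,g')\mapsto g\circ g'$; $1_x^A$ is the identity of $x$. Similarly for $\mathbf{B}$. A groupoid is a category all of whose morphisms are invertible. A matched pair of categories $(\mathbf{A},\mathbf{B},\triangleright,\triangleleft,|\cdots|)$ with object set $S$ consists of a function $|\cdots|:S^3\to S$ and maps ${}_xB_y\times{}_yA_z\to{}_xA_{|xyz|}$, $(f,g)\mapsto f\triangleright g$, and ${}_xB_y\times{}_yA_z\to{}_{|xyz|}B_z$, $(f,g)\mapsto f\triangleleft g$, for all $x,y,z\in S$, such that for all $x,y,z,t\in S$: (i) if ${}_xB_y\times{}_yA_z$ is not empty, then ${}_xA_{|xyz|}\times{}_{|xyz|}B_z$ is not empty; (ii) for $(f,f',g)\in{}_xB_y\times{}_yB_z\times{}_zA_t$: $|xy|yzt||=|xzt|$, $(f\circ f')\triangleright g=f\triangleright(f'\triangleright g)$ and $(f\circ f')\triangleleft g=[f\triangleleft(f'\triangleright g)]\circ(f'\triangleleft g)$; (iii) for $(f,g,g')\in{}_xB_y\times{}_yA_z\times{}_zA_t$: $||xyz|zt|=|xyt|$,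 $f\triangleleft(g\circ g')=(f\triangleleft g)\triangleleft g'$ and $f\triangleright(g\circ g')=(f\triangleright g)\circ[(f\triangleleft g)\triangleright g']$; (iv) for $g\in{}_xA_y$: $|xxy|=y$, $1_x^B\triangleright g=g$ and $1_x^B\triangleleft g=1_y^B$; (v) for $f\in{}_xB_y$: $|xyy|=x$, $f\triangleright1_y^A=1_x^A$ and $f\triangleleft1_y^A=f$. The bicrossed product $\mathbf{A}\Join\mathbf{B}$ is the category with object set $S$, hom-sets ${}_x(\mathbf{A}\Join\mathbf{B})_y=\coprod_{u\in S}{}_xA_u\times{}_uB_y$, identities $(1_x^A,1_x^B)$ and composition $(g,f)\circ(g',f')=(g\circ(f\triangleright g'),(f\triangleleft g')\circ f')$ for $(g,f)\in{}_xA_u\times{}_uB_y$ and $(g',f')\in{}_yA_v\times{}_vB_z$. *)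

(* Defs.v *)
Set Implicit Arguments.
Unset Strict Implicit.
Unset Printing Implicit Defensive.

(* Morphisms are indexed by (target, source): [hom C x y] is the set of
   morphisms from y to x, so [comp g g'] is g o g'. *)
Record category (S : Type) : Type := Category {
  hom :> S -> S -> Type;
  idm : forall x, hom x x;
  comp : forall x y z, hom x y -> hom y z -> hom x z;
  comp1m : forall x y (g : hom x y), comp (idm x) g = g;
  compm1 : forall x y (g : hom x y), comp g (idm y) = g;
  compA : forall x y z t (g : hom x y) (g' : hom y z) (g'' : hom z t),
    comp (comp g g') g'' = comp g (comp g' g'')
}.

Arguments idm {S} c x.

Declare Scope cat_scope.
Delimit Scope cat_scope with cat.
Local Open Scope cat_scope.

Notation "g \o h" := (comp g h) (at level 50) : cat_scope.

Definition is_groupoid (S : Type) (C : category S) : Prop :=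
  forall x y (g : C x y), exists h : C y x,
    g \o h = idm C x /\ h \o g = idm C y.

(* Transport of a morphism along an equality of its source, respectively its
   target: the equations of a matched pair compare morphisms whose endpoints
   are only propositionally equal. *)
Definition cast_src (S : Type) (C : category S) (x y y' : S) (e : y = y')
  (g : C x y) : C x y' := eq_rect y (fun w => C x w) g y' e.

Definition cast_tgt (S : Type) (C : category S) (x x' y : S) (e : x = x')
  (g : C x y) : C x' y := eq_rect x (fun w => C w y) g x' e.

(* [mid x y z] is |xyz|, [lact f g] is f |> g and [ract f g] is f <| g.  The
   function [mid] is total, but its values are only constrained when there are
   morphisms to act on.  Transports use the equalities given by the record
   itself; as S stands for a set, the choice of the proofs of these equalities
   is immaterial.  The field [mid_inhabited] already follows from the existence
   of [lact] and [ract]. *)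
Record matched_pair (S : Type) (A B : category S) : Type := MatchedPair {
  mid : S -> S -> S -> S;
  lact : forall x y z, B x y -> A y z -> A x (mid x y z);
  ract : forall x y z, B x y -> A y z -> B (mid x y z) z;

  mid_inhabited : forall x y z, inhabited (B x y * A y z) ->
    inhabited (A x (mid x y z) * B (mid x y z) z);

  mid_compB : forall x y z t (f : B x y) (f' : B y z) (g : A z t),
    mid x y (mid y z t) = mid x z t;
  lact_compB : forall x y z t (f : B x y) (f' : B y z) (g : A z t),
    lact (f \o f') g = cast_src (mid_compB f f' g) (lact f (lact f' g));
  ract_compB : forall x y z t (f : B x y) (f' : B y z) (g : A z t),
    ract (f \o f') g =
    cast_tgt (mid_compB f f' g) (ract f (lact f' g)) \o ract f' g;

  mid_compA : forall x y z t (f : B x y) (g : A y z) (g' : A z t),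
    mid (mid x y z) z t = mid x y t;
  ract_compA : forall x y z t (f : B x y) (g : A y z) (g' : A z t),
    ract f (g \o g') = cast_tgt (mid_compA f g g') (ract (ract f g) g');
  lact_compA : forall x y z t (f : B x y) (g : A y z) (g' : A z t),
    lact f (g \o g') =
    lact f g \o cast_src (mid_compA f g g') (lact (ract f g) g');

  mid_idB : forall x y (g : A x y), mid x x y = y;
  lact_idB : forall x y (g : A x y),
    cast_src (mid_idB g) (lact (idm B x) g) = g;
  ract_idB : forall x y (g : A x y),
    cast_tgt (mid_idB g) (ract (idm B x) g) = idm B y;

  mid_idA : forall x y (f : B x y), mid x y y = x;
  lact_idA : forall x y (f : B x y),
    cast_src (mid_idA f) (lact f (idm A y)) = idm A x;
  ract_idA : forall x y (f : B x y),
    cast_tgt (mid_idA f) (ract f (idm A y)) = f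
}.

Section Bicrossed.
Variables (S : Type) (A B : category S) (M : matched_pair A B).

Definition bicrossed_hom (x y : S) : Type := {u : S & (A x u * B u y)%type}.

Definition bpair (x u y : S) (g : A x u) (f : B u y) : bicrossed_hom x y :=
  existT _ u (g, f).

Definition bicrossed_id (x : S) : bicrossed_hom x x :=
  bpair (idm A x) (idm B x).

Definition bicrossed_comp (x y z : S) (p : bicrossed_hom x y)
    (p' : bicrossed_hom y z) : bicrossed_hom x z :=
  let (g, f) := projT2 p in
  let (g', f') := projT2 p' in
  bpair (g \o lact M f g') (ract M f g' \o f').

Lemma bpair_cast (x u u' y : S) (e : u = u') (g : A x u) (f : B u y) :
  bpair (cast_src e g) (cast_tgt e f) = bpair g f.
Proof. destruct e; reflexivity. Qed.

Lemma comp_cast_src (C : category S) (x y z z' : S) (e : z = z')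
    (g : C x y) (h : C y z) : g \o cast_src e h = cast_src e (g \o h).
Proof. destruct e; reflexivity. Qed.

Lemma cast_tgt_comp (C : category S) (x x' y z : S) (e : x = x')
    (g : C x y) (h : C y z) : cast_tgt e g \o h = cast_tgt e (g \o h).
Proof. destruct e; reflexivity. Qed.

Lemma bicrossed_comp1m (x y : S) (p : bicrossed_hom x y) :
  bicrossed_comp (bicrossed_id x) p = p.
Proof.
destruct p as [u [g f]]; unfold bicrossed_comp; simpl.
rewrite <- (bpair_cast (mid_idB M g)), <- comp_cast_src, <- cast_tgt_comp.
rewrite lact_idB, ract_idB, !comp1m; reflexivity.
Qed.

Lemma bicrossed_compm1 (x y : S) (p : bicrossed_hom x y) :
  bicrossed_comp p (bicrossed_id y) = p.
Proof.
destruct p as [u [g f]]; unfold bicrossed_comp; simpl.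
rewrite <- (bpair_cast (mid_idA M f)), <- comp_cast_src, <- cast_tgt_comp.
rewrite lact_idA, ract_idA, !compm1; reflexivity.
Qed.

Lemma bicrossed_compA (x y z t : S) (p : bicrossed_hom x y)
    (p' : bicrossed_hom y z) (p'' : bicrossed_hom z t) :
  bicrossed_comp (bicrossed_comp p p') p'' =
  bicrossed_comp p (bicrossed_comp p' p'').
Proof.
destruct p as [u [g f]], p' as [v [g' f']], p'' as [w [g'' f'']].
unfold bicrossed_comp; simpl.
rewrite lact_compB, ract_compB, lact_compA, ract_compA.
rewrite !comp_cast_src, !cast_tgt_comp, !bpair_cast, !compA; reflexivity.
Qed.

Definition bicrossed : category S :=
  Category bicrossed_comp1m bicrossed_compm1 bicrossed_compA.

End Bicrossed.

(* Main.v *)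
(* Every morphism (g, f) factors as (g, 1) o (1, f), and g |-> (g, 1) and
   f |-> (1, f) are functors from A and B to the bicrossed product.  Hence (g, f)
   is a composite of two invertible morphisms. *)

Require Import Defs.

Set Implicit Arguments.
Unset Strict Implicit.

Local Open Scope cat_scope.

(** The body of [is_groupoid] for a single morphism, so [hA] and [hB] prove it by conversion. *)
Definition invertible (S : Type) (C : category S) (x y : S) (g : C x y) : Prop :=
  exists h : C y x, g \o h = idm C x /\ h \o g = idm C y.

Lemma invertible_comp (S : Type) (C : category S) (x y z : S)
    (g : C x y) (g' : C y z) :
  invertible g -> invertible g' -> invertible (g \o g').
Proof.
intros [h [gh hg]] [h' [gh' hg']]; exists (h' \o h); split.
- rewrite compA, <- (compA g'), gh', comp1m; exact gh.
- rewrite compA, <- (compA h), hg, comp1m; exact hg'.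
Qed.

Section BicrossedFactors.
Variables (S : Type) (A B : category S) (M : matched_pair A B).

Definition bicrossed_inA (x y : S) (g : A x y) : bicrossed M x y :=
  bpair g (idm B y).

Definition bicrossed_inB (x y : S) (f : B x y) : bicrossed M x y :=
  bpair (idm A x) f.

(** The inner factors meet as [idm B y] acting on [g'], which axiom (iv) trivialises. *)
Lemma bicrossed_inA_pair (x y u z : S) (g : A x y) (g' : A y u) (f : B u z) :
  bicrossed_inA g \o (bpair g' f : bicrossed M y z) = bpair (g \o g') f.
Proof.
simpl; unfold bicrossed_comp; simpl.
(* The middle object [mid y y u] equals [u] only propositionally: transport both components at once,
   then push the casts onto the actions, where [lact_idB] and [ract_idB] absorb them. *)
rewrite <- (bpair_cast (mid_idB M g')), <- comp_cast_src, <- cast_tgt_comp.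
rewrite lact_idB, ract_idB, comp1m; reflexivity.
Qed.

(** Dual: here [f] acts on [idm A y], and axiom (v) applies. *)
Lemma bicrossed_pair_inB (x u y z : S) (g : A x u) (f : B u y) (f' : B y z) :
  (bpair g f : bicrossed M x y) \o bicrossed_inB f' = bpair g (f \o f').
Proof.
simpl; unfold bicrossed_comp; simpl.
rewrite <- (bpair_cast (mid_idA M f)), <- comp_cast_src, <- cast_tgt_comp.
rewrite lact_idA, ract_idA, compm1; reflexivity.
Qed.

Lemma bicrossed_factor (x u y : S) (g : A x u) (f : B u y) :
  (bpair g f : bicrossed M x y) = bicrossed_inA g \o bicrossed_inB f.
Proof. unfold bicrossed_inA; rewrite bicrossed_pair_inB, comp1m; reflexivity. Qed.

Lemma invertible_inA (x y : S) (g : A x y) :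
  invertible g -> invertible (bicrossed_inA g).
Proof.
intros [h [gh hg]]; exists (bicrossed_inA h).
(* Only the right factor is opened into a pair, the left one staying an [inA]. *)
split; unfold bicrossed_inA at 2; rewrite bicrossed_inA_pair.
- rewrite gh; reflexivity.
- rewrite hg; reflexivity.
Qed.

Lemma invertible_inB (x y : S) (f : B x y) :
  invertible f -> invertible (bicrossed_inB f).
Proof.
intros [h [fh hf]]; exists (bicrossed_inB h).
split; unfold bicrossed_inB at 1; rewrite bicrossed_pair_inB.
- rewrite fh; reflexivity.
- rewrite hf; reflexivity.
Qed.

End BicrossedFactors.

Theorem mainTheorem9 (S : Type) (A B : category S) (M : matched_pair A B)
  (hA : is_groupoid A) (hB : is_groupoid B) : is_groupoid (bicrossed M).
Proof.
intros x y [u [g f]].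
(* Folds the goal so that the factorisation can be rewritten in it. *)
change (invertible (bpair g f : bicrossed M x y)).
rewrite (bicrossed_factor M); apply invertible_comp.
- apply invertible_inA, hA.
- apply invertible_inB, hB.
Qed.
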